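(* There exists a polynomial function $K:\mathbb{N}\to\mathbb{N}$ such that for every $\ell \ge 2$, every digraph $D$ with $\delta^+(D) \ge K(\ell)$ contains a subdivision of every orientation of the cycle $C_\ell$.
   Context: Digraphs are finite, loopless, have no parallel arcs, but may contain digons. $C_\ell$ is the undirected cycle of length $\ell$; an orientation of an undirected simple graph is obtained by replacing each edge $\{u,v\}$ by exactly one of the arcs $(u,v)$, $(v,u)$ (for $\ell=2$ the cycle is understood as a digon-type 2-cycle, as in the paper). A subdivision of a digraph $F$ is obtained by replacing each arc $(x,y)$ of $F$ by a directed path from $x$ to $y$, such that paths corresponding to different arcs are internally vertex-disjoint. $\delta^+(D)$ is the minimum out-degree of $D$. *)

(* Defs.v *)
From mathcomp Require Import all_boot all_algebra.
Set Implicit Arguments. Unset Strict Implicit. Unset Printing Implicit Defensive.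

(* A digraph on a finite vertex type T is an arc relation a : rel T.
   No parallel arcs (a relation); digons allowed; loopless is a hypothesis. *)
Definition loopless (T : finType) (a : rel T) : Prop := forall x, ~~ a x x.

Definition outdeg (T : finType) (a : rel T) (x : T) : nat := #|[set y | a x y]|.

Definition min_outdeg_ge (T : finType) (a : rel T) (k : nat) : Prop :=
  forall x, k <= outdeg a x.

(* An orientation of C_l: the cycle on vertices 'I_l whose i-th edge joins
   i and i+1 (mod l); o i = true orients it i -> i+1, false orients it i+1 -> i.
   For l = 2 this gives the two-edge cycle (directed digon, or two parallel
   arcs with the same direction). *)
Definition ctail (l : nat) (o : 'I_l -> bool) (i : 'I_l) : 'I_l :=
  if o i then i else ordS i.
Definition chead (l : nat) (o : 'I_l -> bool) (i : 'I_l) : 'I_l :=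
  if o i then ordS i else i.

(* The directed path in D replacing arc i: branch vertex f (tail i), internal
   vertices s i, branch vertex f (head i). *)
Definition sub_path (T : finType) (l : nat) (o : 'I_l -> bool)
  (f : 'I_l -> T) (s : 'I_l -> seq T) (i : 'I_l) : seq T :=
  f (ctail o i) :: rcons (s i) (f (chead o i)).

Definition contains_subdivision (T : finType) (a : rel T) (l : nat)
  (o : 'I_l -> bool) : Prop :=
  exists (f : 'I_l -> T) (s : 'I_l -> seq T),
    [/\ injective f,
        (forall i, path a (f (ctail o i)) (rcons (s i) (f (chead o i)))
                   /\ uniq (sub_path o f s i)),
        (forall i j x, x \in s i -> f j != x),
        (forall i j x, i != j -> x \in s i -> x \notin s j) &
        (* different arcs give different paths (relevant only for l = 2) *)
        (forall i j, i != j -> sub_path o f s i != sub_path o f s j)].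

(* Main.v *)
Require Import Defs.
From mathcomp Require Import all_boot all_algebra.
From mathcomp Require Import zify.

(* A constant orientation only needs a long directed cycle, found at the end of
   a longest path.  Otherwise, choose a minimal nonempty vertex set R with at
   most A = O(l^2) out-neighbours outside R; then D[R] still has large minimum
   out-degree.

   In D[R] take a maximal family of disjoint cherries (a root with two disjoint
   out-going legs of length 2l).  The uncovered part Z contains no cherry, so
   every leg can be prolonged by a bounded path inside Z until its tip has few
   out-neighbours in Z.  Then each tip sends almost all of its arcs into the
   covered set, which has only O(l) vertices per cherry; hence the incidence
   between cherries and covered vertices is dense, and a subfamily of cherries
   with a set of sinks has large degree on both tips and at every sink.  Going
   greedily from sink to cherry to sink gives a zigzag path of size O(l^2) with
   as many blocks as required, all of them long.

   It is closed as follows: by minimality of R, each of its two ends reaches,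
   avoiding the rest of the zigzag, more than half of the at most A vertices
   of the boundary of R, so both reach a common one, and two such paths merge at
   a new sink. *)

Set Implicit Arguments. Unset Strict Implicit. Unset Printing Implicit Defensive.

(** * Walks that follow a word of edge directions *)

Definition dir (T : finType) (a : rel T) (b : bool) : rel T :=
  fun x y => if b then a x y else a y x.

(* A walk from [x] traversing the word [w] of edge directions; the entry
   [(s, y)] of [g] stretches one letter to a path through [s] ending at [y].
   Nonempty interiors make the paths of distinct arcs automatically distinct,
   which matters when [l = 2]. *)
Fixpoint strand (T : finType) (a : rel T) (x : T) (w : seq bool)
    (g : seq (seq T * T)) : bool :=
  match w, g with
  | [::], [::] => true
  | b :: w', p :: g' =>
      [&& path (dir a b) x (rcons p.1 p.2), p.1 != [::] & strand a p.2 w' g']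
  | _, _ => false
  end.

(** The starting vertex is left out, so a closed strand lists each of its vertices once and
    disjointness of its pieces is plain [uniq]. *)
Definition verts (T : finType) (g : seq (seq T * T)) : seq T :=
  flatten [seq rcons p.1 p.2 | p <- g].

Lemma verts_cat (T : finType) (g1 g2 : seq (seq T * T)) :
  verts (g1 ++ g2) = verts g1 ++ verts g2.
Proof. by rewrite /verts map_cat flatten_cat. Qed.

Lemma last_verts (T : finType) (x : T) g : last x (verts g) = last x (unzip2 g).
Proof. by elim: g x => //= p g IH x; rewrite last_cat last_rcons IH. Qed.

Lemma strand_size (T : finType) (a : rel T) x w g :
  strand a x w g -> size g = size w.
Proof. by elim: w x g => [|b w IH] x [|p g] //= /and3P[_ _ /IH ->]. Qed.

Lemma strand_cat (T : finType) (a : rel T) x w1 w2 g1 g2 :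
  strand a x w1 g1 -> strand a (last x (verts g1)) w2 g2 ->
  strand a x (w1 ++ w2) (g1 ++ g2).
Proof.
elim: w1 x g1 => [|b w IH] x [|p g] //= /and3P[-> -> /IH{}IH].
by rewrite /verts /= last_cat last_rcons => /IH.
Qed.

Lemma strand_catP (T : finType) (a : rel T) x w1 w2 g :
  strand a x (w1 ++ w2) g ->
  exists g1 g2, [/\ g = g1 ++ g2, strand a x w1 g1 &
                    strand a (last x (verts g1)) w2 g2].
Proof.
elim: w1 x g => [|b w IH] x g /=; first by move=> H; exists [::], g.
case: g => [//|p g] /and3P[H1 H2 /IH[g1 [g2 [-> H3 H4]]]].
exists (p :: g1), g2; rewrite /= H1 H2 H3 /verts /= last_cat last_rcons.
by split.
Qed.

(** Each letter but the last takes two vertices of [q], one as interior and one as end; the last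
    letter takes all that remains. *)
Lemma strand_stretch (T : finType) (a : rel T) b m x q :
  0 < m -> m.*2 <= size q -> path (dir a b) x q ->
  exists2 g, strand a x (nseq m b) g & verts g = q.
Proof.
elim: m x q => // -[|m] IH x q _.
  case/lastP: q => // s y; rewrite size_rcons => Hs Hp.
  exists [:: (s, y)]; last by rewrite /verts /= cats0.
  by rewrite /= Hp; case: s Hs {Hp}.
case: q => [|s [|y q]] // Hq; rewrite 2![path _ _ _]/= => /and3P[H1 H2 Hp].
have [//||g Hg <-] := IH y q _ _ Hp; first by rewrite /= in Hq *; lia.
by exists (([:: s], y) :: g); rewrite // [nseq _ _]/= [strand _ _ _ _]/= H1 H2.
Qed.

Lemma strand_nth (T : finType) (a : rel T) x w g z i :
  strand a x w g -> i < size w ->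
  let p := nth ([::], z) g i in
  path (dir a (nth false w i)) (nth z (x :: unzip2 g) i) (rcons p.1 p.2)
  /\ p.1 != [::].
Proof.
elim: w x g i => [|b w IH] x [|p g] //= [|i] /and3P[H1 H2 H3] //= Hi.
by case: (IH _ _ _ H3 Hi); split.
Qed.

Lemma uniq_flatten_nth (T : eqType) (ss : seq (seq T)) i j x :
  uniq (flatten ss) -> x \in nth [::] ss i -> x \in nth [::] ss j -> i = j.
Proof.
elim: ss i j => [|s ss IH] i j /=; first by rewrite nth_nil.
have sub k : x \in nth [::] ss k -> x \in flatten ss.
  move=> H; apply/flattenP; exists (nth [::] ss k) => //.
  by apply: mem_nth; rewrite ltnNge; apply: contraL H => /(nth_default [::]) ->.
rewrite cat_uniq => /and3P[_ /hasPn Hd Hu].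
case: i j => [|i] [|j] //= Hi Hj.
- by move: (Hd _ (sub _ Hj)); rewrite Hi.
- by move: (Hd _ (sub _ Hi)); rewrite Hj.
- by rewrite (IH i j).
Qed.

Lemma uniq_flatten_in (T : eqType) (ss : seq (seq T)) s :
  uniq (flatten ss) -> s \in ss -> uniq s.
Proof.
elim: ss => // s' ss IH /=; rewrite cat_uniq => /and3P[Hs _ /IH{}IH].
by rewrite inE => /predU1P[-> //|/IH].
Qed.

(** * Closed strands as subdivisions of oriented cycles *)

Definition closed_strand (T : finType) (a : rel T) (w : seq bool) : Prop :=
  exists x g, [/\ strand a x w g, last x (verts g) = x & uniq (verts g)].

(** Rotating the word means starting the same closed walk at another vertex. *)
Lemma closed_strand_catC (T : finType) (a : rel T) w1 w2 :
  closed_strand a (w1 ++ w2) -> closed_strand a (w2 ++ w1).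
Proof.
move=> [x [g [/strand_catP[g1 [g2 [-> H1 H2]]]]]].
rewrite verts_cat last_cat => Hl Hu; exists (last x (verts g1)), (g2 ++ g1).
rewrite verts_cat uniq_catC last_cat Hl; split => //.
by apply: strand_cat; rewrite ?Hl.
Qed.

Lemma closed_strand_subdivision (T : finType) (a : rel T) l (o : 'I_l -> bool) :
  1 < l -> closed_strand a [seq o i | i <- enum 'I_l] ->
  contains_subdivision a o.
Proof.
move=> l1 [x [g [Hs Hl Hu]]].
have szg : size g = l by rewrite (strand_size Hs) size_map size_enum_ord.
pose ys := unzip2 g; have szy : size ys = l by rewrite size_map.
pose t i := (nth ([::], x) g i).1.
pose seg i := rcons (t i) (nth x ys i).
have segE i : i < l -> nth [::] [seq rcons p.1 p.2 | p <- g] i = seg i.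
  by move=> il; rewrite (nth_map ([::], x)) ?szg // /seg (nth_map ([::], x)) ?szg.
have disj (i j : 'I_l) y : y \in seg i -> y \in seg j -> i = j.
  rewrite -!segE // => Hi Hj; apply: val_inj; exact: uniq_flatten_nth Hu Hi Hj.
have useg (i : 'I_l) : uniq (seg i).
  by rewrite -segE //; apply: uniq_flatten_in Hu _; rewrite mem_nth ?size_map ?szg.
(* The branch vertex [f i] is where segment [i] starts, that is, where the cyclically preceding
   segment ends. *)
pose f (i : 'I_l) := nth x ys (ord_pred i).
have fS i : f (ordS i) = nth x ys i by rewrite /f ordSK.
have yseg (i : 'I_l) : nth x ys i \in seg i by rewrite mem_rcons mem_head.
have f_in i : f i \in seg (ord_pred i) by exact: yseg.
(* For [i = 0] this is where closedness enters: the start [x] is the end of the last segment. *)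
have fE (i : 'I_l) : nth x (x :: ys) i = f i.
  rewrite /f; case: i => [[|i] Hi] /=.
    have Hn : l.-1 = (size ys).-1 by rewrite szy.
    by rewrite add0n modn_small ?Hn ?nth_last -?last_verts ?Hl //; lia.
  by rewrite modnDr modn_small //; lia.
have predN (i : 'I_l) : ord_pred i != i.
  apply/eqP => /(congr1 val) /=; case: i => [[|i] Hi] /=.
    by rewrite add0n modn_small; lia.
  by rewrite modnDr modn_small; lia.
have main (i : 'I_l) : path (dir a (o i)) (f i) (seg i) /\ t i != [::].
  have := @strand_nth _ _ _ _ _ x i Hs; rewrite size_map size_enum_ord ltn_ord.
  move=> /(_ isT) /=; rewrite (nth_map i) ?size_enum_ord // nth_ord_enum fE.
  by rewrite /seg /t (nth_map ([::], x)) ?szg.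
have ufs (i : 'I_l) : uniq (f i :: seg i).
  rewrite /= useg andbT; apply/negP => Hf.
  by move: (predN i); rewrite (disj _ _ _ (f_in i) Hf) eqxx.
(* A letter [false] is walked against its arcs, so its interior is reversed to give a directed
   path. *)
pose s (i : 'I_l) := if o i then t i else rev (t i).
have mem_s i y : (y \in s i) = (y \in t i) by rewrite /s; case: ifP; rewrite ?mem_rev.
have tseg i y : y \in t i -> y \in seg i by rewrite mem_rcons inE orbC => ->.
have spE i : Defs.sub_path o f s i = if o i then f i :: seg i else rev (f i :: seg i).
  rewrite /Defs.sub_path /ctail /chead /s; case: (o i); rewrite fS //.
  by rewrite /seg rev_cons rev_rcons.
have yt (i : 'I_l) : nth x ys i \notin t i.
  by move: (useg i); rewrite rcons_uniq => /andP[].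
exists f, s; split.
- move=> i j Hij; apply: (can_inj (@ord_predK l)).
  by apply: disj (f_in i) _; rewrite Hij.
- move=> i; rewrite spE; split; last by case: (o i); rewrite ?rev_uniq.
  have [Hp _] := main i; rewrite /ctail /chead /s.
  case: (o i) Hp; rewrite fS // /seg => Hp.
  by have := rev_path a (f i) (rcons (t i) (nth x ys i));
    rewrite last_rcons belast_rcons rev_cons => ->.
- move=> i j y; rewrite mem_s => Hy; apply/eqP => E; subst y.
  have /= E := disj _ _ _ (f_in j) (tseg _ _ Hy).
  by move: (yt i); rewrite -{1}E; move/negP; apply.
- move=> i j y nij; rewrite !mem_s => Hi; apply/negP => Hj.
  by rewrite (disj _ _ _ (tseg _ _ Hi) (tseg _ _ Hj)) eqxx in nij.
(* Equal paths would have equal interiors, but interiors are nonempty and disjoint. *)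
- move=> i j nij; apply/eqP => E.
  have Es : s i = s j.
    by case: E => _ /(congr1 (fun u => rev u)); rewrite !rev_rcons => -[_ /(can_inj revK)].
  have [_ ] := main i; case Ht: (t i) => [//|y u] _.
  have Hi : y \in t i by rewrite Ht mem_head.
  have Hj : y \in t j by rewrite -mem_s -Es mem_s.
  by rewrite (disj _ _ _ (tseg _ _ Hi) (tseg _ _ Hj)) eqxx in nij.
Qed.

(** * Cyclic words as sequences of blocks *)

(** Each pair leads from a sink backwards to a source and then forwards to the next sink; its
    entries count the letters of the two stretches. *)
Definition zigzag_word (bs : seq (nat * nat)) : seq bool :=
  flatten [seq nseq p.1 false ++ nseq p.2 true | p <- bs].

(** The prefix of [true] serves the induction: it becomes the forward part of a new block once a
    [false] is put in front of it. *)
Lemma zigzag_wordP (w : seq bool) :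
  last true w -> exists n bs, [/\ w = nseq n true ++ zigzag_word bs,
    all (fun p => (0 < p.1) && (0 < p.2)) bs & size bs <= size w].
Proof.
elim: w => [|b w IH] /=; first by exists 0, [::].
case: b => Hl.
  by have [n [bs [-> H1 H2]]] := IH Hl; exists n.+1, bs; split => //; lia.
have /IH[[|n] [bs [Ew H1 H2]]] : last true w by case: w Hl {IH}.
  case: bs Ew H1 H2 => [|[m m'] bs] Ew H1 H2; first by rewrite Ew in Hl.
  exists 0, ((m.+1, m') :: bs); split => /=; first by rewrite Ew.
    by move: H1 => /= /andP[/andP[_ ->] ->].
  exact: leq_trans H2 _.
by exists 0, ((1, n.+1) :: bs); split => //=; rewrite Ew.
Qed.

(** Cut between a [true] and a [false] right after it; if there is no such place, all [false]
    precede all [true] and the word itself will do. *)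
Lemma zigzag_rotation (w : seq bool) :
  true \in w -> false \in w ->
  exists w1 w2, w = w1 ++ w2 /\ ~~ head true (w2 ++ w1) /\ last false (w2 ++ w1).
Proof.
move=> Ht Hf.
suff [[w1 [w2 ->]]|[Hh Hl]] : (exists w1 w2, w = w1 ++ true :: false :: w2)
    \/ (~~ head true w /\ last false w).
- exists (rcons w1 true), (false :: w2).
  by rewrite cat_rcons /= last_cat last_rcons.
- by exists [::], w; rewrite cats0.
case: w Ht Hf => // b w; elim: w b => [|c w IH] b; first by case: b.
case: b => Ht Hf.
  case: c Ht Hf => Ht Hf; last by left; exists [::], w.
  by have [||[w1 [w2 ->]]|[]] := IH true; rewrite ?inE //; left; exists (true :: w1), w2.
rewrite /=; case: c Ht Hf => Ht Hf.
  case Hw : (false \in w); last first.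
    by right; split => //; elim: w Hw {IH Ht Hf} => // -[] w IHw.
  have [||[w1 [w2 ->]]|[]] := IH true; rewrite ?inE ?Hw //.
  by left; exists (false :: w1), w2.
have Ht' : true \in false :: w by move: Ht; rewrite !inE.
have [//||[w1 [w2 ->]]|[_ Hl]] := IH false; rewrite ?inE //.
- by left; exists (false :: w1), w2.
- by right.
Qed.

(** * Degrees into a set and long directed cycles *)

Definition degin (T : finType) (a : rel T) (Z : {set T}) (x : T) : nat :=
  #|[set y in Z | a x y]|.

Lemma fresh_element (T : finType) (S : {set T}) (s : seq T) :
  size s < #|S| -> exists2 y, y \in S & y \notin s.
Proof.
move=> H; case: (pickP [pred y | (y \in S) && (y \notin s)]) => [y /andP[]|H0].
  by exists y.
suff Hs : #|S| <= size s by rewrite ltnNge Hs in H.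
apply: leq_trans (card_size s); apply: subset_leq_card; apply/subsetP => y yS.
by move: (H0 y); rewrite /= yS => /negbFE.
Qed.

(** All out-neighbours of the end of a longest path lie on the path; closing it at the first of them
    gives a cycle through them all. *)
Lemma directed_cycle (T : finType) (a : rel T) n :
  0 < #|T| -> min_outdeg_ge a n ->
  exists x q, [/\ path a x q, last x q = x, uniq q & n <= size q].
Proof.
move=> /card_gt0P[x0 _] Hd.
pose P m := [exists x, [exists q : m.-tuple T, path a x q && uniq (x :: q)]].
have P0 : exists m, P m.
  by exists 0; apply/existsP; exists x0; apply/existsP; exists [tuple].
have bP m : P m -> m <= #|T|.
  case/existsP=> x /existsP[q /andP[_ Hu]].
  have := card_uniqP Hu; rewrite /= size_tuple => E.
  by have := max_card (mem (x :: q)); rewrite E; apply: ltnW.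
case: (ex_maxnP P0 bP) => m /existsP[x /existsP[q /andP[Hp Hu]]] Hm.
have Hin y : a (last x q) y -> y \in x :: q.
  move=> Hy; apply/negPn/negP => yN.
  suff /Hm : P m.+1 by rewrite ltnn.
  apply/existsP; exists x; apply/existsP; exists [tuple of rcons q y].
  by rewrite rcons_path Hp Hy -[x :: _]/(rcons (x :: q) y) rcons_uniq yN Hu.
have [n0|n0] := posnP n; first by exists x, (rev [::]); subst.
have [|y0 Hy0 _] := @fresh_element _ [set y | a (last x q) y] [::].
  exact: leq_trans n0 (Hd _).
pose N := [set y | a (last x q) y].
have hasN : has (mem N) (x :: q).
  by apply/hasP; exists y0 => //; apply: Hin; rewrite inE in Hy0.
set i := find (mem N) (x :: q); have il : i < size (x :: q) by rewrite -has_find.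
have yN := nth_find x hasN; rewrite -/i in yN.
case Ed : (drop i (x :: q)) (drop_nth x il) => [//|y p2] [Ey Ep].
rewrite -Ey /= inE in yN.
have Hp2 : path a y p2 by have := @drop_sorted _ a i (x :: q) Hp; rewrite Ed.
have Hl : last y p2 = last x q.
  by have := congr1 (last x) (cat_take_drop i (x :: q)); rewrite Ed last_cat.
exists y, (rcons p2 y); rewrite rcons_path last_rcons Hp2 Hl yN; split=> //.
  have : uniq (drop i (x :: q)) by apply: drop_uniq.
  by rewrite Ed /= rcons_uniq.
have : n <= #|N| by exact: Hd.
move=> nN; rewrite size_rcons; apply: (leq_trans nN).
apply: leq_trans (card_size (y :: p2)); apply/subset_leq_card/subsetP => z zN.
have : z \in x :: q by apply: Hin; rewrite inE in zN.
rewrite -(cat_take_drop i (x :: q)) mem_cat -Ed => /orP[|//] /(nthP x)[j].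
rewrite size_takel ?(ltnW il) // => ji; rewrite nth_take // => Ej.
by have := before_find x ji; rewrite Ej /= zN.
Qed.

(** * Cherries and how to find them *)

(* A cherry is encoded as [(root, leg, leg)], the two legs being directed paths
   out of the root that exclude it. *)
Definition leg (T : finType) (c : T * seq T * seq T) (b : bool) : seq T :=
  if b then c.2 else c.1.2.

Definition cherry_verts (T : finType) (c : T * seq T * seq T) : seq T :=
  c.1.1 :: leg c false ++ leg c true.

Definition tip (T : finType) (c : T * seq T * seq T) (b : bool) : T :=
  last c.1.1 (leg c b).

(** The lower bound leaves room to stretch a block over a leg; the upper bound keeps the cherry
    small for counting. *)
Definition is_cherry (T : finType) (a : rel T) (lo hi : nat)
    (c : T * seq T * seq T) : bool :=
  uniq (cherry_verts c) &&
  [forall b, path a c.1.1 (leg c b) && (lo <= size (leg c b) <= hi)].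

Definition has_cherry (T : finType) (a : rel T) (h : nat) (Z : {set T}) : bool :=
  [exists x, [exists q1 : h.-tuple T, [exists q2 : h.-tuple T,
    is_cherry a h h (x, tval q1, tval q2) &&
    all (mem Z) (cherry_verts (x, tval q1, tval q2))]]].

Definition covered (T : finType) (cs : seq (T * seq T * seq T)) : seq T :=
  flatten [seq cherry_verts c | c <- cs].

Lemma covered_cons (T : finType) c (cs : seq (T * seq T * seq T)) :
  covered (c :: cs) = cherry_verts c ++ covered cs.
Proof. by []. Qed.

Lemma has_cherry_sub (T : finType) (a : rel T) h (Z Z' : {set T}) :
  Z \subset Z' -> has_cherry a h Z -> has_cherry a h Z'.
Proof.
move=> /subsetP sZ /existsP[x /existsP[q1 /existsP[q2 /andP[H1 /allP H2]]]].
apply/existsP; exists x; apply/existsP; exists q1; apply/existsP; exists q2.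
by rewrite H1; apply/allP => y /H2 /sZ.
Qed.

(** At most [h] vertices of [X] and at most [h] of the path so far are forbidden, while the current
    end has more than [2 * h] out-neighbours in [Z]. *)
Lemma grow_path (T : finType) (a : rel T) (Z : {set T}) h X z n :
  z \in Z ->
  (forall q, path a z q -> uniq (z :: q) -> {subset q <= Z} -> size q < h ->
     2 * h < degin a Z (last z q)) ->
  size X <= h -> n <= h ->
  exists q, [/\ size q = n, path a z q, uniq (z :: q), {subset q <= Z} &
                ~~ has (mem X) q].
Proof.
move=> zZ Hd Xh; elim: n => [|n IH] nh; first by exists [::].
have [q [sq Hp Hu qZ qX]] := IH (ltnW nh).
have Hq : size q < h by rewrite sq.
have [|y] := @fresh_element _ [set y in Z | a (last z q) y] (X ++ z :: q).
  by apply: leq_trans (Hd _ Hp Hu qZ Hq); rewrite size_cat /= sq ltnS mul2n -addnn leq_add.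
rewrite inE mem_cat negb_or => /andP[yZ ay] /andP[yX yq].
exists (rcons q y); rewrite size_rcons sq rcons_path Hp ay -rcons_cons rcons_uniq.
rewrite yq Hu has_rcons /= (negbTE yX); split=> // v.
by rewrite mem_rcons inE => /predU1P[->|/qZ].
Qed.

(** The first leg is grown freely, the second with the first as forbidden set. *)
Lemma cherry_exists (T : finType) (a : rel T) (Z : {set T}) h z :
  z \in Z ->
  (forall q, path a z q -> uniq (z :: q) -> {subset q <= Z} -> size q < h ->
     2 * h < degin a Z (last z q)) ->
  has_cherry a h Z.
Proof.
move=> zZ Hd.
have [//|//|q1 [s1 p1 u1 Z1 _]] := @grow_path _ _ _ _ [::] _ h zZ Hd.
have [||q2 [s2 p2 u2 Z2 X2]] := @grow_path _ _ _ _ q1 _ h zZ Hd; rewrite ?s1 //.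
apply/existsP; exists z; move/eqP: s1 => s1; move/eqP: s2 => s2.
apply/existsP; exists (Tuple s1); apply/existsP; exists (Tuple s2).
rewrite /is_cherry /cherry_verts /leg /=; apply/andP; split.
  apply/andP; split; last by apply/forallP => -[]; rewrite /= ?p1 ?p2 ?(eqP s1) ?(eqP s2) leqnn.
  move: u1 u2 => /= /andP[zq1 u1] /andP[zq2 u2].
  by rewrite mem_cat negb_or zq1 zq2 cat_uniq u1 u2 X2.
by rewrite zZ /=; apply/allP => v; rewrite mem_cat => /orP[/Z1|/Z2].
Qed.

(** * Packings of cherries whose tips send most arcs into the packing *)

Lemma greedy_packing (T : finType) (a : rel T) h (U : {set T}) :
  exists cs, [/\ all (is_cherry a h h) cs,
    uniq (covered cs),
    {subset covered cs <= U} &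
    ~~ has_cherry a h (U :\: [set y in covered cs])].
Proof.
have [n] := ubnP #|U|; elim: n U => // n IH U Un.
have [|noc] := boolP (has_cherry a h U); last first.
  exists [::]; split => //; apply: contra noc; apply: has_cherry_sub.
  exact: subsetDl.
case/existsP=> x /existsP[q1 /existsP[q2 /andP[Hc /allP HU]]].
set c := (x, tval q1, tval q2) in Hc HU.
pose U' := U :\: [set y in cherry_verts c].
have ltU : #|U'| < n.
  apply: leq_trans (_ : #|U| <= n) => //; apply: proper_card.
  apply/properP; split; first exact: subsetDl.
  exists x; first by apply: HU; rewrite mem_head.
  by rewrite !inE eqxx.
have [cs [H1 H2 H3 H4]] := IH U' ltU; exists (c :: cs); split.
- by rewrite /= Hc.
- rewrite covered_cons cat_uniq H2 andbT; apply/andP; split.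
    by case/andP: Hc.
  by apply/hasPn => y /H3; rewrite inE [in X in X && _]inE => /andP[].
- by move=> y; rewrite covered_cons mem_cat => /orP[/HU //|/H3]; rewrite inE => /andP[].
- apply: contra H4; apply: has_cherry_sub; apply/subsetP => y.
  rewrite in_setD inE covered_cons mem_cat negb_or => /andP[/andP[yc yC] yU].
  by rewrite !in_setD !in_set yc yC yU.
Qed.

(* If every short path from [z] in [Z] ended at a vertex with many out-neighbours
   in [Z], two legs could be grown from [z] greedily. *)
Lemma settle_leg (T : finType) (a : rel T) h (Z : {set T}) e :
  ~~ has_cherry a h Z ->
  exists r, [/\ path a e r, uniq r, {subset r <= Z}, size r <= h &
                degin a Z (last e r) <= 2 * h].
Proof.
move=> noc; have [He|He] := leqP (degin a Z e) (2 * h); first by exists [::].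
have [|z] := @fresh_element _ [set y in Z | a e y] [::]; first by apply: leq_ltn_trans He.
rewrite inE => /andP[zZ aez] _.
have [/existsP[q /and5P[H1 H2 H3 H4 H5]]|/existsPn Hn] := boolP [exists q : {bseq h of T},
  [&& size q < h, path a z q, uniq (z :: q), all (mem Z) q & degin a Z (last z q) <= 2 * h]].
  exists (z :: q); split=> //; first by rewrite /= aez.
  by move=> v; rewrite inE => /predU1P[->|/(allP H4)].
case/negP: noc; apply: (cherry_exists zZ) => q H1 H2 H3 H4.
have := Hn (Bseq (ltnW H4)); rewrite /= H1 H4.
move: H2 => /= ->; rewrite (_ : all _ q) /= -?ltnNge //.
by apply/allP => v /H3.
Qed.

Lemma degin_sub (T : finType) (a : rel T) (Z Z' : {set T}) x :
  Z \subset Z' -> degin a Z x <= degin a Z' x.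
Proof.
move=> /subsetP sZ; apply/subset_leq_card/subsetP => y.
by rewrite !inE => /andP[/sZ -> ->].
Qed.

(** The tips are prolonged one after the other, the second inside what the first leaves of [Z]; each
    leg grows by at most [h]. *)
Lemma settle_cherry (T : finType) (a : rel T) h (Z : {set T}) c :
  is_cherry a h h c -> ~~ has_cherry a h Z ->
  {in cherry_verts c, forall y, y \notin Z} ->
  exists c', [/\ is_cherry a h (2 * h) c',
    {in cherry_verts c', forall y, (y \in cherry_verts c) || (y \in Z)},
    {subset cherry_verts c <= cherry_verts c'} &
    forall b, degin a (Z :\: [set y in cherry_verts c']) (tip c' b) <= 2 * h].
Proof.
case: c => [[x q1] q2] /andP[Hu /forallP Hleg] noc cZ.
have [r1 [p1 u1 s1 l1 d1]] := settle_leg (tip (x, q1, q2) false) noc.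
pose Z1 := Z :\: [set y in r1].
have noc1 : ~~ has_cherry a h Z1 by apply: contra noc; apply/has_cherry_sub/subsetDl.
have [r2 [p2 u2 s2 l2 d2]] := settle_leg (tip (x, q1, q2) true) noc1.
have s2' : {subset r2 <= Z} by move=> y /s2; rewrite inE => /andP[].
pose c' := (x, q1 ++ r1, q2 ++ r2).
have Ep : perm_eq (cherry_verts c') ((r1 ++ r2) ++ cherry_verts (x, q1, q2)).
  apply/permP => P; rewrite /cherry_verts /leg /= !count_cat /= !count_cat; lia.
exists c'; split.
- apply/andP; split.
    rewrite (perm_uniq Ep) cat_uniq Hu andbT cat_uniq u1 u2 andbT andTb.
    apply/andP; split; apply/hasPn => y; first by move/s2; rewrite !inE => /andP[].
    by move=> yc; rewrite mem_cat; apply/negP => /orP[/s1|/s2'] yZ; move: (cZ _ yc); rewrite yZ.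
  apply/forallP => b; have := Hleg b; case: b => /andP[Hp /andP[lo hi]];
  rewrite /leg /= cat_path Hp size_cat ?p1 ?p2 /=; move: lo hi; rewrite /leg /=; lia.
- move=> y; rewrite (perm_mem Ep) !mem_cat => /orP[/orP[/s1|/s2']|] ->; by rewrite ?orbT.
- by move=> y; rewrite (perm_mem Ep) mem_cat orbC => ->.
- have sub b : Z :\: [set y in cherry_verts c'] \subset (if b then Z1 else Z).
    case: b; last exact: subsetDl.
    apply/setDS/subsetP => y; rewrite !in_set (perm_mem Ep) !mem_cat => ->; by rewrite ?orbT.
  move=> b; apply: leq_trans (degin_sub a _ (sub b)) _.
  by case: b; rewrite /tip /= last_cat.
Qed.

(** The cherries are settled in turn. Later ones only shrink the uncovered set, so degree bounds
    obtained earlier persist. *)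
Lemma settle_packing (T : finType) (a : rel T) h (Z : {set T}) cs :
  all (is_cherry a h h) cs -> uniq (covered cs) -> ~~ has_cherry a h Z ->
  {in covered cs, forall y, y \notin Z} ->
  exists cs', [/\ size cs' = size cs,
    all (is_cherry a h (2 * h)) cs' /\ uniq (covered cs'),
    {in covered cs', forall y, (y \in covered cs) || (y \in Z)},
    {subset covered cs <= covered cs'} &
    {in cs', forall c b, degin a (Z :\: [set y in covered cs']) (tip c b) <= 2 * h}].
Proof.
elim: cs Z => [|c cs IH] Z; first by move=> *; exists [::].
rewrite [all _ _]/= covered_cons cat_uniq => /andP[Hc Hcs] /and3P[_ /hasPn Hd Hu] noc HZ.
have [|c' [Hc' sub' sup' deg']] := settle_cherry Hc noc.
  by move=> y yc; apply: HZ; rewrite mem_cat yc.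
pose Z1 := Z :\: [set y in cherry_verts c'].
have sZ1 : Z1 \subset Z by exact: subsetDl.
have [||cs' [H1 [H2 H3] H4 H4' H5]] := IH Z1 Hcs Hu.
- by apply: contra noc; apply: has_cherry_sub.
- move=> y yc; have : y \notin Z by apply: HZ; rewrite mem_cat yc orbT.
  by apply: contra; apply/subsetP.
have eqZ : Z :\: [set y in covered (c' :: cs')] = Z1 :\: [set y in covered cs'].
  by apply/setP => y; rewrite !in_setD !in_set covered_cons mem_cat negb_or andbCA andbA.
exists (c' :: cs'); split; rewrite ?eqZ.
- by rewrite /= H1.
- split; first by rewrite /= Hc'.
  rewrite covered_cons cat_uniq H3 andbT; apply/andP; split; first by case/andP: Hc'.
  apply/hasPn => y /H4 /orP[ycs|].
    apply/negP => /sub' /orP[|yZ]; first by apply/negP/Hd.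
    by move: (HZ y); rewrite mem_cat ycs orbT yZ => /(_ isT).
  by rewrite in_setD in_set => /andP[].
- move=> y; rewrite !covered_cons !mem_cat => /orP[/sub' /orP[]->|/H4 /orP[->|]];
  rewrite ?orbT //.
  by move=> /(subsetP sZ1) ->; rewrite orbT.
- move=> y; rewrite !covered_cons !mem_cat => /orP[/sup' ->//|/H4' ->]; by rewrite orbT.
- move=> c0; rewrite inE => /predU1P[->|/H5 //] b.
  by apply: leq_trans (deg' b); apply/degin_sub/subsetDl.
Qed.

(** A settled tip has at least [k] out-neighbours in [U] and at most [2 * h] of them are
    uncovered. *)
Lemma absorbing_packing (T : finType) (a : rel T) h k (U : {set T}) z :
  z \in U -> {in U, forall x, k <= degin a U x} -> 2 * h < k ->
  exists cs, [/\ cs != [::], all (is_cherry a h (2 * h)) cs, uniq (covered cs),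
    {subset covered cs <= U} &
    {in cs, forall c b, k - 2 * h <= degin a [set y in covered cs] (tip c b)}].
Proof.
move=> zU Hk hk; have [cs [H1 H2 H3 H4]] := greedy_packing a h U.
have Hcs : cs != [::].
  (* With an empty packing all of [U] would be free of cherries, against its large degrees. *)
  apply/eqP => E; case/negP: H4; rewrite E; apply: (@cherry_exists _ _ _ _ z).
    by rewrite !inE zU.
  move=> q _ _ qU _; apply: leq_trans hk _.
  have lU : last z q \in U.
    by have := mem_last z q; rewrite inE => /predU1P[->|/qU]; rewrite ?inE.
  apply: leq_trans (Hk _ lU) _; apply/degin_sub/subsetP => y yU; by rewrite !inE.
have [|cs' [S1 [S2 S3] S4 S4' S5]] := settle_packing H1 H2 H4.
  by move=> y yc; rewrite !inE yc.
have S6 : {subset covered cs' <= U}.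
  by move=> y /S4 /orP[/H3 //|]; rewrite inE => /andP[].
exists cs'; split => //; first by case: cs' S1 {S2 S3 S4 S4' S5 S6}; case: cs Hcs {H1 H2 H3 H4}.
move=> c cc b; have tU : tip c b \in U.
  apply/S6/flattenP; exists (cherry_verts c); first exact: map_f.
  rewrite /tip /cherry_verts inE mem_cat.
  have := mem_last c.1.1 (leg c b); rewrite inE => /predU1P[->|]; first by rewrite eqxx.
  by case: b => ->; rewrite ?orbT.
have := S5 _ cc b; have := Hk _ tU; rewrite /degin.
set A := [set y in U | _]; set B := [set y in _ :\: _ | _]; set C := [set y in _ | _].
move=> kA Bh; suff : #|A| <= #|B| + #|C|.
  by move=> AB; rewrite leq_subLR; apply: leq_trans kA (leq_trans AB _); rewrite leq_add2r.
rewrite -cardsUI; apply: leq_trans (leq_addr _ _); apply/subset_leq_card/subsetP => y.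
rewrite !inE => /andP[yU ay]; rewrite yU ay !andbT.
case E : (y \in covered cs') => //=.
by rewrite orbF; apply: contraFN E => /S4'.
Qed.

(** * A core with large degrees on both sides *)

(* The pair [(C, S)] maximises the truncated edge count plus a reward of [m + d]
   per discarded index and [2 * d] per discarded vertex; truncation at [m] forces
   both sides of a kept index to have degree at least [d]. *)
Lemma two_sided_core (I T : finType) (N : I -> bool -> {set T}) (Q : {set T}) m d :
  (forall i b, N i b \subset Q) -> (forall i b, m <= #|N i b|) ->
  2 * d * #|Q| + d * #|I| < m * #|I| ->
  exists (C : {set I}) (S : {set T}), [/\ C != set0, S \subset Q,
    {in C, forall i b, d <= #|N i b :&: S|} &
    {in S, forall t, d <= #|[set i in C | [exists b, t \in N i b]]|}].
Proof.
move=> NQ Nm big.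
pose w (S : {set T}) i b := minn m #|N i b :&: S|.
pose sc (p : {set I} * {set T}) :=
  \sum_(i in p.1) \sum_b w p.2 i b + (m + d) * #|~: p.1| + 2 * d * #|Q :\: p.2|.
have [[C S] _ mx] := @arg_maxnP _ (setT, Q) predT sc isT.
have wm S' i b : w S' i b <= m by exact: geq_minl.
have top : 2 * m * #|I| <= sc (C, S).
  apply: leq_trans (mx (setT, Q) isT).
  rewrite /sc /= setCT cards0 setDv cards0 !muln0 !addn0.
  rewrite (eq_bigr (fun _ => 2 * m)) => [|i _].
    by rewrite sum_nat_const cardsT mulnC.
  by rewrite big_bool /= /w !(setIidPl (NQ _ _)) !(minn_idPl (Nm _ _)) mul2n addnn.
(* With [C] empty the score is at most [(m + d) * #|I| + 2 * d * #|Q|], which [big] puts below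
   [2 * m * #|I|]. *)
have C0 : C != set0.
  apply/eqP => E; move: top; rewrite /sc /= E big_set0 setC0 cardsT.
  have : #|Q :\: S| <= #|Q| by apply/subset_leq_card/subsetDl.
  move: big; move: #|Q :\: S| #|Q| #|I| => x y z; nia.
exists C, (S :&: Q); split => //; first exact: subsetIr.
(* Discarding [i] would earn [m + d], so its two truncated degrees add up to at least that; as
   neither exceeds [m], each is at least [d]. *)
- move=> i iC b; rewrite setIA setIAC (setIidPl (NQ _ _)).
  have := mx (C :\ i, S) isT; rewrite /sc /= (big_setD1 i iC) /=.
  have -> : #|~: (C :\ i)| = #|~: C|.+1.
    by rewrite setDE setCI setCK setUC cardsU1 inE iC.
  rewrite mulnS => H; have {H} : m + d <= \sum_b w S i b.
    move: H; move: (\sum_(j in C :\ i) _) (\sum_b w S i b) ((m + d) * _) (2 * d * _).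
    by move=> x y u v; lia.
  rewrite big_bool /= => H.
  have : d <= w S i b by have := wm S i (~~ b); case: b H => /=;
    move: (w S i true) (w S i false) => u v; lia.
  by rewrite leq_min => /andP[].
(* Discarding [t] would earn [2 * d] and cost at most 2 for every kept index adjacent to it. *)
- move=> t; rewrite inE => /andP[tS tQ].
  have := mx (C, S :\ t) isT; rewrite /sc /=.
  have -> : #|Q :\: (S :\ t)| = #|Q :\: S|.+1.
    rewrite (_ : Q :\: (S :\ t) = t |: (Q :\: S)) ?cardsU1 ?inE ?tS //.
    by apply/setP => y; rewrite !inE; case: eqP => [->|] //=; rewrite tS tQ.
  have le i : \sum_b w S i b <= \sum_b w (S :\ t) i b + 2 * [exists b, t \in N i b].
    have wb b : w S i b <= w (S :\ t) i b + (t \in N i b).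
      rewrite /w setIDA.
      have : #|N i b :&: S| <= #|(N i b :&: S) :\ t| + (t \in N i b).
        by rewrite (cardsD1 t (N i b :&: S)) inE tS andbT addnC.
      lia.
    rewrite !big_bool /=; case: (boolP [exists b, _]) => [_|/existsPn Hn].
      have := wb true; have := wb false; do 2 case: (t \in _); lia.
    by have := wb true; have := wb false; rewrite (negbTE (Hn _)) (negbTE (Hn _)); lia.
  have : \sum_(i in C) \sum_b w S i b <= \sum_(i in C) \sum_b w (S :\ t) i b
      + 2 * #|[set i in C | [exists b, t \in N i b]]|.
    apply: (@leq_trans (\sum_(i in C)
      (\sum_b w (S :\ t) i b + 2 * [exists b, t \in N i b]))).
      by apply: leq_sum => i _; exact: le.
    rewrite big_split /= leq_add2l -big_distrr /= leq_mul2l /= -sum1dep_card big_mkcondr /=.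
    by apply: leq_sum => i _; case: [exists b, _].
  move: (\sum_(i in C) \sum_b w S i b) (\sum_(i in C) \sum_b w (S :\ t) i b) => x y.
  rewrite mulnS; move: ((m + d) * _) (2 * d * #|_|) #|[set i in C | _]| => u v n.
  lia.
Qed.

(** * Greedy construction of the zigzag *)

(** By disjointness each vertex of [X] spoils at most one index. *)
Lemma fresh_index (I T : finType) (V : I -> seq T) (C : {set I}) (X : seq T) :
  (forall i j v, v \in V i -> v \in V j -> i = j) -> size X < #|C| ->
  exists2 i, i \in C & ~~ has (mem X) (V i).
Proof.
move=> disj; elim: X C => [|v X IH] C.
  by move=> /card_gt0P[i iC]; exists i; rewrite // (eq_has (a2 := pred0)) ?has_pred0.
move=> szX.
suff [C' [sC ltX vC]] : exists C' : {set I},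
    [/\ C' \subset C, size X < #|C'| & {in C', forall i, v \notin V i}].
  have [i iC HX] := IH C' ltX; exists i; first exact: (subsetP sC).
  apply/hasPn => y yV; rewrite inE negb_or (hasPn HX) // andbT.
  by apply: contraTneq yV => ->; apply: vC.
have [/existsP[i /andP[iC vi]]|/existsPn Hn] := boolP [exists i, (i \in C) && (v \in V i)].
  exists (C :\ i); split; first exact: subsetDl.
    by move: szX; rewrite (cardsD1 i C) iC.
  move=> j; rewrite !inE => /andP[ji _]; apply: contraNN ji => vj.
  by rewrite (disj _ _ _ vj vi).
exists C; split=> //; first exact: ltnW.
by move=> i iC; have := Hn i; rewrite iC.
Qed.

Lemma rev_path_dir (T : finType) (a : rel T) x t q :
  path a x (rcons q t) -> path (dir a false) t (rev (x :: q)).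
Proof.
by move=> Hp; have := rev_path (dir a false) x (rcons q t);
  rewrite last_rcons belast_rcons => ->.
Qed.

Lemma cherry_traversal_perm (T : finType) (c : T * seq T * seq T) b t :
  perm_eq (rev (c.1.1 :: leg c b) ++ rcons (leg c (~~ b)) t)
          (rcons (cherry_verts c) t).
Proof.
apply/permP => P; rewrite -!cats1 !count_cat count_rev /cherry_verts /= !count_cat.
by case: b => /=; lia.
Qed.

(** One block goes from the sink [t] up a leg whose tip has an arc to [t], and from the root down
    the other leg to a fresh sink. The used vertices are added to [X]: at most [B] for the cherry
    and one for the sink, which the bound on [d] allows for every block. *)
Lemma zigzag_strand (I T : finType) (a : rel T) (c : I -> T * seq T * seq T)
    (C : {set I}) (S U : {set T}) n h B d bs t X :
  (forall i, is_cherry a n h (c i)) ->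
  (forall i j v, v \in cherry_verts (c i) -> v \in cherry_verts (c j) -> i = j) ->
  (forall i, {subset cherry_verts (c i) <= U}) -> S \subset U ->
  2 * h < B ->
  {in C, forall i b, d <= #|[set y in S | a (tip (c i) b) y]|} ->
  {in S, forall y, d <= #|[set i in C | [exists b, a (tip (c i) b) y]]|} ->
  all (fun p => (0 < p.1) && (0 < p.2)) bs ->
  all (fun p => (p.1.*2 <= n) && (p.2.*2 <= n)) bs ->
  t \in S -> size X + size bs * B.+1 < d ->
  exists g, [/\ strand a t (zigzag_word bs) g, uniq (verts g),
    {subset verts g <= U}, ~~ has (mem X) (verts g) &
    last t (verts g) \in S /\ size (verts g) <= size bs * B.+1].
Proof.
move=> Hc disj cU /subsetP SU hB dC dS.
elim: bs t X => [|[m m'] bs IH] t X; first by move=> *; exists [::].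
move=> /= /andP[/andP[m0 m'0] bs0] /andP[/andP[mn m'n] bsn] tS szX.
have [|i] := @fresh_index _ _ (fun i => cherry_verts (c i))
  [set i in C | [exists b, a (tip (c i) b) t]] X disj.
  by apply: leq_trans (dS _ tS); lia.
rewrite inE => /andP[iC /existsP[b ab]] iX.
have szc : size (cherry_verts (c i)) <= B.
  have /andP[_ /forallP Hl] := Hc i; rewrite /= size_cat.
  have /andP[_ /andP[_]] := Hl true; have /andP[_ /andP[_]] := Hl false.
  by rewrite /leg; lia.
have [|t' ] := @fresh_element _ [set y in S | a (tip (c i) (~~ b)) y] (X ++ cherry_verts (c i)).
  by apply: leq_trans (dC _ iC _); rewrite size_cat; lia.
rewrite inE mem_cat negb_or => /andP[t'S ab'] /andP[t'X t'c].
have [|g [Hg ug gU gX [lg szg]]] :=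
  IH t' (X ++ cherry_verts (c i) ++ [:: t']) bs0 bsn t'S.
  move: szX szc; rewrite 2!size_cat [size [:: t']]/= mulSn.
  move: (size (cherry_verts _)) (size bs * _) => u v.
  move: (size X) => x; lia.
have /andP[uc /forallP Hl] := Hc i.
have /andP[pb /andP[nb _]] := Hl b; have /andP[pb' /andP[nb' _]] := Hl (~~ b).
have pF : path (dir a false) t (rev ((c i).1.1 :: leg (c i) b)).
  by apply: rev_path_dir; rewrite rcons_path pb.
have szF : m.*2 <= size (rev ((c i).1.1 :: leg (c i) b)).
  by rewrite size_rev; apply: leqW; apply: leq_trans nb.
have [g1 G1 V1] := strand_stretch m0 szF pF.
have lF : last t (rev ((c i).1.1 :: leg (c i) b)) = (c i).1.1 by rewrite rev_cons last_rcons.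
have pT : path (dir a true) (c i).1.1 (rcons (leg (c i) (~~ b)) t').
  by rewrite rcons_path /= /dir; apply/andP.
have szT : m'.*2 <= size (rcons (leg (c i) (~~ b)) t').
  by rewrite size_rcons; apply: leqW; apply: leq_trans nb'.
have [g2 G2 V2] := strand_stretch m'0 szT pT.
have Ev : perm_eq (verts (g1 ++ g2 ++ g)) (rcons (cherry_verts (c i)) t' ++ verts g).
  by rewrite !verts_cat V1 V2 catA perm_cat2r cherry_traversal_perm.
exists (g1 ++ g2 ++ g); split.
- rewrite /zigzag_word /= -catA; apply: strand_cat G1 _; rewrite V1 lF.
  by apply: strand_cat G2 _; rewrite V2 last_rcons.
- rewrite (perm_uniq Ev) cat_uniq rcons_uniq t'c uc ug /= andbT.
  apply: contra gX => /hasP[y yg yc]; apply/hasP; exists y => //.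
  have {yc} : y \in rcons (cherry_verts (c i)) t' by [].
  rewrite mem_rcons in_cons => yc; change (y \in X ++ cherry_verts (c i) ++ [:: t']).
  rewrite !mem_cat mem_seq1.
  by case/orP: yc => ->; rewrite ?orbT.
- move=> y; rewrite (perm_mem Ev) mem_cat mem_rcons inE -orbA.
  by case/or3P => [/eqP->|/cU|/gU] //; apply: SU.
- rewrite (eq_has_r (perm_mem Ev)) has_cat has_rcons.
  apply/norP; split; first by apply/norP.
  by apply: contra gX => /hasP[y yg yX]; apply/hasP; exists y => //; rewrite inE mem_cat;
    apply/orP; left.
- rewrite (perm_size Ev) size_cat size_rcons; split; last by rewrite mulSn leq_add.
  by rewrite !verts_cat !last_cat V2 last_rcons.
Qed.

(** * Closing the zigzag through the boundary of a minimal set *)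

(** A path leaving the initial sink is read backwards and absorbed by the first letter [false], so
    the word does not change. *)
Lemma strand_prepend (T : finType) (a : rel T) t w g p v :
  strand a t (false :: w) g -> path a t (rcons p v) ->
  exists2 g', strand a v (false :: w) g' & verts g' = rev (t :: p) ++ verts g.
Proof.
case: g => [//|[s y] g] /= /and3P[Hp s0 Hg] Hv.
exists ((rev (t :: p) ++ s, y) :: g); last by rewrite /verts /= rcons_cat catA.
rewrite /= Hg rcons_cat cat_path (rev_path_dir Hv) rev_cons last_rcons Hp.
by case: (s) s0 => //; case: (rcons _ _).
Qed.

(** The final letter [true] absorbs a path that leaves the last sink. *)
Lemma strand_append (T : finType) (a : rel T) x w g p v :
  strand a x (rcons w true) g -> path a (last x (verts g)) (rcons p v) ->
  exists2 g', strand a x (rcons w true) g' & verts g' = verts g ++ rcons p v.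
Proof.
rewrite -cats1 => /strand_catP[g1 [g2 [-> H1]]].
case: g2 => [//|[s y] [|? ?]] /=; last by rewrite !andbF.
rewrite verts_cat => /and3P[Hp s0 _]; rewrite /verts /= cats0 last_cat last_rcons => Hv.
exists (g1 ++ [:: (rcons s y ++ p, v)]).
  apply: strand_cat H1 _; rewrite /= rcons_cat cat_path Hp last_rcons Hv !andbT.
  by case: (s).
by rewrite map_cat flatten_cat /= cats0 rcons_cat catA.
Qed.

Definition out_boundary (T : finType) (a : rel T) (R : {set T}) : {set T} :=
  [set y | (y \notin R) && [exists x in R, a x y]].

(* [B] consists of boundary vertices of [R] reached from [s] off [P]: the reachable
   set misses [s'], so by minimality its boundary is large, and that boundary
   lies in [P] together with the boundary of [R]. *)
Lemma reach_boundary (T : finType) (a : rel T) (R : {set T}) A P s s' :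
  {subset P <= R} -> s \in P -> s' \in P -> s != s' ->
  (forall Y : {set T}, Y != set0 -> Y \proper R -> A < #|out_boundary a Y|) ->
  exists2 B : {set T}, B \subset out_boundary a R & A < #|B| + size P /\
    {in B, forall y, exists p, path a s (rcons p y) /\
      all (fun z => z \notin P) (rcons p y)}.
Proof.
move=> PR sP s'P ss' Rmin.
(* Only heads of arcs are restricted, so the search can start at [s] although [s] lies in [P]. *)
pose r x y := a x y && (y \in R :\: [set z in P]).
pose Y := [set y | connect r s y].
have YR y : y \in Y -> (y == s) || (y \in R :\: [set z in P]).
  rewrite inE => /connectP[p Hp ->]; case/lastP: p Hp => [|p z]; first by rewrite /= eqxx.
  by rewrite rcons_path last_rcons => /and3P[_ _ ->]; rewrite orbT.
have YR' y : y \in Y -> y \in R.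
  by move/YR; rewrite !inE => /orP[/eqP->|/andP[_]] //; apply: PR.
have Y0 : Y != set0 by apply/set0Pn; exists s; rewrite inE connect0.
have YpR : Y \proper R.
  apply/properP; split; first exact/subsetP.
  exists s'; first exact: PR.
  by apply/negP => /YR; rewrite eq_sym (negbTE ss') !inE s'P.
exists (out_boundary a Y :&: out_boundary a R); first exact: subsetIr.
split.
  apply: leq_trans (Rmin _ Y0 YpR) _.
  rewrite -(cardsID (out_boundary a R) (out_boundary a Y)) leq_add2l.
  apply: leq_trans (card_size P); apply/subset_leq_card/subsetP => y.
  rewrite inE => /andP[yR]; rewrite inE => /andP[yY /existsP[x /andP[xY ax]]].
  apply/negPn/negP => yP; case/negP: yY; rewrite inE.
  have yR' : y \in R.
    apply/negPn/negP => yR'; case/negP: yR; rewrite inE yR'.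
    by apply/existsP; exists x; rewrite ax YR'.
  move: xY; rewrite inE => sx; apply: connect_trans sx (connect1 _).
  by rewrite /r ax !inE yR' yP.
move=> y; rewrite !inE => /andP[/andP[_ /existsP[x /andP[xY ax]]] /andP[yR _]].
move: xY; rewrite inE => /connectP[p Hp Ex]; exists p; rewrite rcons_path -Ex ax andbT.
split; first by apply: sub_path Hp => u v /andP[].
rewrite all_rcons; apply/andP; split; first by apply: contra yR => /PR.
by elim: p (s) Hp {Ex} => //= z p IH u /andP[/andP[_]] ; rewrite !inE => /andP[-> _] /IH ->.
Qed.

Lemma uniq_path_to (T : finType) (a : rel T) s p v :
  path a s (rcons p v) -> v != s ->
  exists p', [/\ path a s (rcons p' v), uniq (rcons p' v) & {subset p' <= p}].
Proof.
move=> Hp vs; have := last_rcons s p v; case/shortenP: Hp => p'.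
move=> Hp' up' sub ls; case/lastP: p' Hp' up' sub ls => [|p' w].
  by move=> _ _ _ /= sv; rewrite sv eqxx in vs.
rewrite last_rcons => Hp' /= /andP[_ up'] sub wv; rewrite wv in Hp' up' sub.
exists p'; split=> // z zp.
have := sub z; rewrite !mem_rcons !inE zp orbT => /(_ isT) /predU1P[zv|//].
by move: up'; rewrite rcons_uniq -zv zp.
Qed.

Lemma merging_paths (T : finType) (a : rel T) (R : {set T}) A P s s' :
  {subset P <= R} -> s \in P -> s' \in P -> s != s' ->
  #|out_boundary a R| <= A -> 2 * size P <= A ->
  (forall Y : {set T}, Y != set0 -> Y \proper R -> A < #|out_boundary a Y|) ->
  exists p q v, [/\ path a s (rcons p v), path a s' (rcons q v),
    uniq (p ++ rcons q v) & all (fun z => z \notin P) (p ++ rcons q v)].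
Proof.
move=> PR sP s'P ss' RA PA Rmin.
have [B BR [szB HB]] := reach_boundary PR sP s'P ss' Rmin.
rewrite eq_sym in ss'.
have [B' BR' [szB' HB']] := reach_boundary PR s'P sP ss' Rmin.
(* Both sets have more than [A - size P] elements and lie in a set of at most [A]; since
   [2 * size P <= A], they meet. *)
have /card_gt0P[y] : 0 < #|B :&: B'|.
  have : #|B :|: B'| <= #|out_boundary a R|.
    by apply: subset_leq_card; rewrite subUset BR BR'.
  have := cardsUI B B'; move: szB szB' RA PA.
  move: #|B| #|B'| #|_| #|_| #|_| (size P) => *; lia.
rewrite inE => /andP[/HB[p [Hp Pp]] /HB'[q [Hq Pq]]].
have hq : has (mem (rcons p y)) (rcons q y).
  by apply/hasP; exists y; rewrite /= ?mem_rcons ?mem_head.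
(* Here [v] is the first vertex of the second path that lies on the first; both are cut there and
   then shortened to simple paths. *)
case/split_find: hq Hq Pq => v q1 q2 vp q1p Hq Pq.
have {vp} vp : v \in rcons p y by [].
case/path.splitP: vp Hp Pp q1p => p1 p2 Hp Pp q1p.
move: Hp Hq Pp Pq; rewrite !cat_path !all_cat.
move=> /andP[Hp _] /andP[Hq _] /andP[Pp _] /andP[Pq _].
have vP : v \notin P by move: Pp; rewrite all_rcons => /andP[].
have [|p' [Hp' up' sp']] := uniq_path_to Hp; first by apply: contraNneq vP => ->.
have [|q' [Hq' uq' sq']] := uniq_path_to Hq; first by apply: contraNneq vP => ->.
exists p', q', v; split=> //.
  rewrite cat_uniq uq' andbT; move: (up'); rewrite rcons_uniq => /andP[vp' ->] /=.
  apply/hasPn => z; rewrite mem_rcons inE => /predU1P[->|/sq' zq] //=.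
  apply/negP => /sp' zp; case/hasP: q1p; exists z; rewrite // inE mem_cat mem_rcons inE zp.
  by rewrite orbT.
rewrite all_cat; move: Pp Pq; rewrite !all_rcons => /andP[_ Pp] /andP[_ Pq].
rewrite vP /=; apply/andP; split; first by apply/allP => z /sp'; apply: (allP Pp).
by apply/allP => z /sq'; apply: (allP Pq).
Qed.

(** * Choice of constants and assembly *)

Lemma size_covered (T : finType) (a : rel T) n h cs :
  all (is_cherry a n h) cs -> size (covered cs) <= (2 * h).+1 * size cs.
Proof.
elim: cs => // c cs IH /andP[/andP[_ /forallP Hc] /IH{}IH].
rewrite covered_cons size_cat [size (c :: cs)]/= mulnS leq_add // /= ltnS size_cat mul2n -addnn.
have /andP[_ /andP[_ hf]] := Hc false; have /andP[_ /andP[_ ht]] := Hc true.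
exact: leq_add.
Qed.

(** The whole vertex set has empty boundary, so a qualifying set of least cardinality exists. *)
Lemma minimal_small_boundary (T : finType) (a : rel T) A :
  0 < #|T| -> exists R : {set T}, [/\ R != set0, #|out_boundary a R| <= A &
    forall Y : {set T}, Y != set0 -> Y \proper R -> A < #|out_boundary a Y|].
Proof.
move=> T0; pose good (Y : {set T}) := (Y != set0) && (#|out_boundary a Y| <= A).
have gT : good setT.
  rewrite /good -card_gt0 cardsT T0 (_ : out_boundary a _ = set0) ?cards0 //.
  by apply/setP => y; rewrite !inE.
have [R /andP[R0 RA] mn] := @arg_minnP _ setT good (fun Y : {set T} => #|Y|) gT.
exists R; split=> // Y Y0 /proper_card YR; rewrite ltnNge; apply/negP => YA.
by have := mn Y; rewrite /good Y0 YA leqNgt YR => /(_ isT).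
Qed.

Lemma degin_boundary (T : finType) (a : rel T) (R : {set T}) k x :
  min_outdeg_ge a k -> x \in R -> k - #|out_boundary a R| <= degin a R x.
Proof.
move=> Hk xR; rewrite leq_subLR addnC; apply: leq_trans (Hk x) _.
rewrite -cardsUI; apply: leq_trans (leq_addr _ _); apply/subset_leq_card/subsetP => y.
rewrite !inE => ax; rewrite ax andbT; case: (y \in R) => //=.
by apply/existsP; exists x; rewrite xR.
Qed.

(** Legs have at least [2 * l] vertices, enough for [l] letters, and at most [4 * l] once settled. A
    cherry thus has at most [8 * l + 1] vertices, a block adds [8 * l + 2] with its sink, and the
    density needed for the core reads [2 * d * (8 * l + 1) + d < k - 4 * l]. *)
Lemma zigzag_structure (T : finType) (a : rel T) (U : {set T}) l k d z bs :
  z \in U -> {in U, forall x, k <= degin a U x} ->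
  0 < l -> d * (16 * l + 3) + 4 * l < k -> bs != [::] ->
  all (fun p => (0 < p.1) && (0 < p.2)) bs ->
  all (fun p => (p.1 <= l) && (p.2 <= l)) bs ->
  (size bs * (8 * l + 2)).+1 < d ->
  exists t g, [/\ strand a t (zigzag_word bs) g, uniq (t :: verts g),
    {subset t :: verts g <= U}, last t (verts g) != t &
    size (verts g) <= size bs * (8 * l + 2)].
Proof.
move=> zU Hk l0 kd bs0 bsp bsl szd.
have hk : 2 * (2 * l) < k by nia.
have [cs [cs0 Hcs ucs csU Hdeg]] := absorbing_packing zU Hk hk.
pose c0 := head (z, [::], [::]) cs.
pose c (i : 'I_(size cs)) := nth c0 cs i.
have cin i : c i \in cs by apply: mem_nth.
pose Q := [set y in covered cs].
pose N i b := [set y in Q | a (tip (c i) b) y].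
have Hc i : is_cherry a (2 * l) (2 * (2 * l)) (c i) by apply: (allP Hcs).
have disj i j v : v \in cherry_verts (c i) -> v \in cherry_verts (c j) -> i = j.
  rewrite /c -!(nth_map c0 [::]) // => vi vj; apply: val_inj.
  exact: uniq_flatten_nth ucs vi vj.
have [|||C [S [C0 SQ dC dS]]] := @two_sided_core _ _ N Q (k - 2 * (2 * l)) d.
- by move=> i b; apply/subsetP => y; rewrite inE => /andP[].
- by move=> i b; apply: Hdeg.
- rewrite card_ord.
  have QB : #|Q| <= (2 * (2 * (2 * l))).+1 * size cs.
    by apply: leq_trans (size_covered Hcs); rewrite cardsE card_size.
  have cs1 : 0 < size cs by rewrite lt0n size_eq0.
  apply: (@leq_ltn_trans (d * (16 * l + 3) * size cs)).
    by move: QB; move: #|Q| (size cs) => u v; nia.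
  by rewrite ltn_pmul2r //; lia.
have SU : S \subset U.
  by apply/subsetP => y /(subsetP SQ); rewrite inE => /csU.
have [i iC] := set0Pn _ C0.
have [t] : exists t, t \in S.
  have /card_gt0P[t] : 0 < #|N i true :&: S|
    by apply: leq_trans (dC _ iC true); apply: leq_ltn_trans szd.
  by rewrite inE => /andP[_ tS]; exists t.
move=> tS.
(* Forbidding [t] from the start keeps the walk from returning to its first sink. *)
have [||||||g [Hg ug gU gt [lg szg]]] := @zigzag_strand _ _ a c C S U (2 * l)
  (2 * (2 * l)) (8 * l + 1) d bs t [:: t] Hc disj _ SU _ _ _ bsp _ tS.
- by move=> j y yc; apply/csU/flattenP; exists (cherry_verts (c j)) => //; apply: map_f.
- lia.
- move=> j jC b; apply: leq_trans (dC _ jC b) _; apply/subset_leq_card/subsetP => y.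
  by rewrite !inE => /andP[/andP[_ ->] ->].
- move=> y yS; apply: leq_trans (dS _ yS) _; apply/subset_leq_card/subsetP => j.
  rewrite !inE => /andP[-> /existsP[b]]; rewrite !inE => /andP[_ ab].
  by apply/existsP; exists b.
- by apply: sub_all bsl => p; rewrite mul2n !leq_double.
- by move: szd; rewrite [8 * l + 2]addnS.
have tg : t \notin verts g.
  by apply: contra gt => tg; apply/hasP; exists t => //; rewrite /= inE eqxx.
exists t, g; split=> //.
- by rewrite /= tg.
- by move=> y; rewrite inE => /predU1P[->|/gU] //; apply: (subsetP SU).
- apply: contraNneq tg => lt; case Eg : (verts g) lt => [|y s] /=;
    last by move=> <-; apply: mem_last.
  case: bs bs0 bsp Hg {szd bsl szg} => // -[[|m] m'] bs // _ _.
  by case: g Eg {ug gU gt lg} => // -[s y] g; rewrite /verts /= ; case: s.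
- by rewrite [8 * l + 2]addnS.
Qed.

Lemma size_zigzag_word_ge bs :
  all (fun p => (0 < p.1) && (0 < p.2)) bs -> size bs <= size (zigzag_word bs).
Proof.
elim: bs => // p bs IH /= /andP[/andP[p1 _] /IH H].
by rewrite !size_cat !size_nseq -add1n leq_add // addn_gt0 p1.
Qed.

Lemma block_size_le bs p :
  p \in bs -> p.1 + p.2 <= size (zigzag_word bs).
Proof.
elim: bs => // q bs IH; rewrite inE /= !size_cat !size_nseq => /predU1P[->|/IH].
  exact: leq_addr.
by move=> H; apply: leq_trans H (leq_addl _ _).
Qed.

Lemma zigzag_closed_strand (T : finType) (a : rel T) l bs :
  1 < l -> 0 < #|T| -> min_outdeg_ge a (400 * l ^ 3) -> bs != [::] ->
  all (fun p => (0 < p.1) && (0 < p.2)) bs -> size (zigzag_word bs) <= l ->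
  closed_strand a (zigzag_word bs).
Proof.
move=> l1 T0 Hk bs0 bsp szw.
(* The value [22 * l ^ 2] is at least twice the size of the zigzag, which is at most
   [l * (8 * l + 2) + 1]. *)
have [R [/set0Pn[z zR] RA Rmin]] := minimal_small_boundary a (22 * l ^ 2) T0.
have szb : size bs <= l.
  exact: leq_trans (size_zigzag_word_ge bsp) szw.
have szP : (size bs * (8 * l + 2)).+1 <= l * (8 * l + 2) + 1.
  by rewrite addn1 ltnS leq_mul2r szb orbT.
(* The core degree [20 * l ^ 2] exceeds the size of the zigzag, and [400 * l ^ 3] pays for it, for
   the cherries and for the boundary of [R]. *)
have [|||||t [g [Hg ug gR lg szg]]] := @zigzag_structure _ a R l
  (400 * l ^ 3 - 22 * l ^ 2) (20 * l ^ 2) z bs zR _ _ _ bs0 bsp.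
- move=> x xR; apply: leq_trans (degin_boundary Hk xR); exact: leq_sub2l.
- exact: ltnW.
- by move: l1; clear; rewrite !expnS expn0 !muln1 => l1; nia.
- apply/allP => p pbs; have := leq_trans (block_size_le pbs) szw.
  by clear; lia.
- apply: leq_ltn_trans szP _.
  by move: l1; clear; rewrite !expnS expn0 !muln1 => l1; nia.
have lP : last t (verts g) \in t :: verts g by apply: mem_last.
have [||p [q [v [Hp Hq upq pqP]]]] := @merging_paths _ a R (22 * l ^ 2) (t :: verts g)
  t (last t (verts g)) gR (mem_head _ _) lP _ RA _ Rmin.
- by rewrite eq_sym.
- apply: (@leq_trans (2 * (l * (8 * l + 2) + 1))).
    rewrite leq_mul2l /=; apply: leq_trans szP; exact: szg.
  by move: l1; clear; rewrite !expnS expn0 !muln1 => l1; nia.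
(* The word starts with [false] and ends with [true], so its outer letters absorb the two merging
   paths and the strand closes at the new sink [v]. *)
have [w1 Ew] : exists w, zigzag_word bs = false :: w.
  by case: (bs) bs0 bsp => // -[[|m] m'] bs' //= _ _; eexists.
have [w2 Ew2] : exists w, zigzag_word bs = rcons w true.
  case/lastP: (bs) bs0 bsp => // bs' [m [|m']] _; rewrite all_rcons ?andbF //= => _.
  exists (zigzag_word bs' ++ nseq m false ++ nseq m' true).
  by rewrite /zigzag_word map_rcons flatten_rcons !rcons_cat; do 2 congr (_ ++ _);
    elim: (m') => //= n' <-.
rewrite Ew in Hg; have [g1 Hg1 V1] := strand_prepend Hg Hp.
have L1 : last v (verts g1) = last t (verts g).
  by rewrite V1 last_cat rev_cons last_rcons.
rewrite -L1 in Hq; rewrite -Ew Ew2 in Hg1.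
have [g2 Hg2 V2] := strand_append Hg1 Hq.
exists v, g2; rewrite Ew2; split=> //; first by rewrite V2 last_cat last_rcons.
have Ep : perm_eq (verts g2) ((t :: verts g) ++ (p ++ rcons q v)).
  rewrite V2 V1; apply/permP => P; rewrite !count_cat count_rev /=.
  by rewrite [RHS]addnA (addnAC _ (count P p)).
rewrite (perm_uniq Ep) cat_uniq ug upq andbT; apply/hasPn => y yp.
exact: (allP pqP).
Qed.

(** A directed cycle with two vertices per letter is stretched over the word, and is read backwards
    for [false]. *)
Lemma constant_closed_strand (T : finType) (a : rel T) l b :
  0 < l -> 0 < #|T| -> min_outdeg_ge a l.*2 -> closed_strand a (nseq l b).
Proof.
move=> l0 T0 /(directed_cycle T0)[x [q [Hp Hl uq szq]]].
case: b; first by have [g Hg Vg] := strand_stretch (b := true) l0 szq Hp; exists x, g; rewrite Vg.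
case/lastP: q Hp Hl uq szq => [|q y] Hp; first by case: l l0.
rewrite last_rcons => yx; rewrite yx in Hp *; move=> uq szq.
have {}Hp := rev_path_dir Hp; rewrite rev_cons in Hp.
have [|g Hg Vg] := strand_stretch l0 _ Hp; first by rewrite size_rcons size_rev -(size_rcons q x).
exists x, g; rewrite Vg last_rcons; split=> //.
by move: uq; rewrite !rcons_uniq mem_rev rev_uniq.
Qed.

(** * The polynomial bound for all orientations *)

Local Open Scope ring_scope.

Theorem theorem1p6 :
  exists K : nat -> nat,
    (exists p : {poly rat}, forall n : nat, (K n)%:R = p.[n%:R]) /\
    (forall l : nat, (2 <= l)%N ->
     forall (T : finType) (a : rel T),
       loopless a -> (0 < #|T|)%N -> min_outdeg_ge a (K l) ->
       forall o : 'I_l -> bool, contains_subdivision a o).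
Proof.
exists (fun l => 400 * l ^ 3)%N; split.
  by exists (400%:R *: 'X^3) => n; rewrite hornerZ hornerXn GRing.natrM GRing.natrX.
move=> l l2 T a _ T0 Hk o; apply: closed_strand_subdivision => //.
set w := [seq o i | i <- enum 'I_l].
have szw : size w = l by rewrite size_map size_enum_ord.
(* A word that misses one of the two letters is constant. *)
have constant b : ~~ b \notin w -> closed_strand a w.
  move=> bw; have -> : w = nseq l b.
    rewrite -szw; apply/all_pred1P/allP => c cw /=.
    by apply: contraNT bw => cb; have <- : c = ~~ b by case: (c) (b) cb => -[].
  apply: constant_closed_strand => // [|x]; first exact: ltnW.
  by apply: leq_trans (Hk x); move: l2; clear; rewrite !expnS expn0; nia.
have [tw|/(constant false) //] := boolP (true \in w).
have [fw|/(constant true) //] := boolP (false \in w).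
have [w1 [w2 [Ew [Hh Hl]]]] := zigzag_rotation tw fw.
rewrite Ew; apply: closed_strand_catC.
have [|n [bs [Eb bsp _]]] := @zigzag_wordP (w2 ++ w1).
  by case: (w2 ++ w1) Hl Hh.
(* The rotated word begins with [false], so it has no prefix of [true] and consists of full
   blocks. *)
have n0 : n = 0%N by case: n Eb Hh => // n ->.
rewrite n0 /= in Eb; rewrite Eb; apply: (@zigzag_closed_strand _ _ l) => //.
  by apply/eqP => bs0; move: Hl; rewrite Eb bs0.
by rewrite -Eb size_cat addnC -size_cat -Ew szw.
Qed.
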